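(* Let $k$ be a field, $m$ a positive integer, and $a_1,\ldots,a_m$ positive integers. Let $\mathfrak{p}=\mathfrak{p}_k(a_1,\ldots,a_m)$ be the kernel of the $k$-algebra homomorphism $\phi_k:k[x_1,\ldots,x_m]\to k[t]$ given by $\phi_k(x_i)=t^{a_i}$ for $i=1,\ldots,m$. Let $\alpha_1,\alpha_2,\beta_1,\ldots,\beta_m,t,T$ be indeterminates over $k$, and consider the injective $k$-algebra homomorphism \[ \xi: k[x_1,\ldots,x_m,T]\longrightarrow k(\alpha_1,\alpha_2,\beta_1,\ldots,\beta_m,t) \] given by $\xi(T)=\alpha_2/\alpha_1$ and $\xi(x_i)=\alpha_1\beta_i+t^{a_i}$ for $i=1,\ldots,m$. Then, inside $k(\alpha_1,\alpha_2,\beta_1,\ldots,\beta_m,t)$, \[ k(\alpha_1\beta_1+t^{a_1},\ \alpha_1\beta_2+t^{a_2},\ \ldots,\ \alpha_1\beta_m+t^{a_m},\ \alpha_2/\alpha_1)\ \cap\ k[\alpha_1,\alpha_2,\beta_1,\ldots,\beta_m,t]\ =\ \xi\bigl(R_s(\mathfrak{p})\bigr). \]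
   Context: Rings are commutative with unit. For a prime ideal $P$ of a ring $A$ and $r\ge 0$, the $r$-th symbolic power is $P^{(r)}=P^rA_P\cap A$ (the preimage of $P^rA_P$ in $A$). The symbolic Rees ring of $P$ is the subring $R_s(P)=\bigoplus_{r\ge 0}P^{(r)}T^r$ of the polynomial ring $A[T]$. In the claim $A=k[x_1,\ldots,x_m]$ with $x_1,\ldots,x_m$ indeterminates over $k$, so $R_s(\mathfrak{p})\subset k[x_1,\ldots,x_m,T]$. The notation $k(\cdots)$ denotes the subfield generated over $k$ and $k[\cdots]$ the polynomial ring. *)

(* Defs.v *)
From HB Require Import structures.
From mathcomp Require Import all_boot all_order all_algebra.
From mathcomp Require Import mpoly.
Set Implicit Arguments.
Unset Strict Implicit.
Unset Printing Implicit Defensive.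
Import GRing.Theory.
Local Open Scope ring_scope.

Notation "x %:F" := (@FracField.tofrac _ x) : ring_scope.

Section SymbolicPower.
Variables (A : idomainType) (P : prime_idealr A).

(* The power P^r, as the ideal generated by the r-fold products of elements
   of P; the coefficients c make P^0 the unit ideal. *)
Definition ideal_pow (r : nat) (f : A) : Prop :=
  exists n (c : 'I_n -> A) (g : 'I_n -> 'I_r -> A),
    (forall i j, g i j \in P) /\ f = \sum_(i < n) c i * \prod_(j < r) g i j.

(* A is a domain, so the local ring A_P is taken inside the field of fractions
   of A, and A -> A_P is an inclusion. *)
Definition in_localization (y : {fraction A}) : Prop :=
  exists f s : A, s \notin P /\ y = f%:F / s%:F.

(* The ideal I A_P of A_P generated by the image of an ideal I of A. *)
Definition localized_ideal (I : A -> Prop) (y : {fraction A}) : Prop :=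
  exists n (u : 'I_n -> {fraction A}) (g : 'I_n -> A),
    (forall i, in_localization (u i) /\ I (g i)) /\
    y = \sum_(i < n) u i * (g i)%:F.

Definition symbolic_pow (r : nat) (f : A) : Prop :=
  localized_ideal (ideal_pow r) f%:F.

Definition symbolic_rees (F : {poly A}) : Prop :=
  forall r, symbolic_pow r F`_r.

End SymbolicPower.

(* The subfield iota(k)(S) of K generated over k by S. The case x / 0 = 0 of
   the last constructor is harmless, since 0 lies in every subfield. *)
Inductive gen_subfield (k K : fieldType) (iota : k -> K) (S : seq K) :
    K -> Prop :=
| gen_subfield_base c : gen_subfield iota S (iota c)
| gen_subfield_mem x : x \in S -> gen_subfield iota S x
| gen_subfield_sub x y :
    gen_subfield iota S x -> gen_subfield iota S y ->
    gen_subfield iota S (x - y)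
| gen_subfield_div x y :
    gen_subfield iota S x -> gen_subfield iota S y ->
    gen_subfield iota S (x / y).

Section MonomialCurve.
Variables (k : fieldType) (m : nat) (a : 'I_m -> nat).

Definition phi (f : {mpoly k[m]}) : {poly k} :=
  mmap (@polyC k) (fun i => 'X^(a i)) f.

HB.instance Definition _ :=
  GRing.RMorphism.copy phi (mmap (@polyC k) (fun i => 'X^(a i))).

Definition curve_ideal : {pred {mpoly k[m]}} := [pred f | phi f == 0].

Lemma curve_ideal_idealr_closed : idealr_closed curve_ideal.
Proof.
split; rewrite ?inE ?rmorph0 ?rmorph1 ?oner_eq0 // => f u v.
by rewrite !inE rmorphD rmorphM /= => /eqP-> /eqP->; rewrite mulr0 addr0.
Qed.

Lemma curve_ideal_prime : prime_idealr_closed curve_ideal.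
Proof. by move=> u v; rewrite !inE rmorphM mulf_eq0. Qed.

HB.instance Definition _ :=
  isIdealr.Build {mpoly k[m]} curve_ideal curve_ideal_idealr_closed.
HB.instance Definition _ :=
  isPrimeIdealrClosed.Build {mpoly k[m]} curve_ideal curve_ideal_prime.

End MonomialCurve.

Arguments curve_ideal k {m} a.

(* k[alpha1, alpha2, beta_1, ..., beta_m, t], with its variables numbered in
   this order, and its field of fractions. *)
Notation ambient_poly k m := {mpoly k[(2 + m + 1)%N]}.
Notation ambient_field k m := {fraction ambient_poly k m}.

Section Xi.
Variables (k : fieldType) (m : nat).

Definition alpha1 : ambient_field k m :=
  ('X_(lshift 1 (lshift m 0)))%:F.
Definition alpha2 : ambient_field k m :=
  ('X_(lshift 1 (lshift m 1)))%:F.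
Definition beta (i : 'I_m) : ambient_field k m :=
  ('X_(lshift 1 (rshift 2 i)))%:F.
Definition tvar : ambient_field k m :=
  ('X_(rshift (2 + m) 0))%:F.

Definition ambient_const (c : k) : ambient_field k m := (c%:MP)%:F.

HB.instance Definition _ :=
  GRing.RMorphism.copy ambient_const
    (@FracField.tofrac (ambient_poly k m) \o @mpolyC (2 + m + 1) k).

Variable a : 'I_m -> nat.

Definition xi_var (i : 'I_m) : ambient_field k m :=
  alpha1 * beta i + tvar ^+ a i.

(* k[x_1, ..., x_m, T] is represented as k[x_1, ..., x_m][T]. *)
Definition xi (F : {poly {mpoly k[m]}}) : ambient_field k m :=
  (map_poly (mmap ambient_const xi_var) F).[alpha2 / alpha1].

HB.instance Definition _ :=
  GRing.RMorphism.copy xi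
    (horner_eval (alpha2 / alpha1) \o map_poly (mmap ambient_const xi_var)).

Lemma xiC c : xi c%:MP%:P = ambient_const c.
Proof. by rewrite /xi map_polyC hornerC /= mmapC. Qed.

Lemma xi_x i : xi ('X_i)%:P = alpha1 * beta i + tvar ^+ a i.
Proof. by rewrite /xi map_polyC hornerC /= mmapX mmap1U. Qed.

Lemma xi_T : xi 'X = alpha2 / alpha1.
Proof. by rewrite /xi map_polyX hornerX. Qed.

End Xi.

Arguments alpha1 {k m}.
Arguments alpha2 {k m}.
Arguments beta {k m} i.
Arguments tvar {k m}.
Arguments ambient_const {k m} c.
Arguments xi k {m} a F.

(* Main.v *)
(* Put A = k[x]. In k[beta,t][alpha1], an element f of A lies in p^(r) iff
   alpha1^r divides f(t^a + alpha1 beta). If s f lies in p^r with s outside p,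
   then alpha1^r divides s(...) f(...), and the constant term of s(...) is
   phi(s) <> 0. Conversely, some u in A_p lifts t^d, with d dividing every a_i;
   Taylor expansion of f at u^b, b_i = a_i / d, involves only terms of order at
   least r in the elements x_i - u^(b_i) of p A_p.
   Given z = xi(G) / xi(H) in the polynomial ring, clear the powers of alpha1
   and specialize alpha1 = 1, t = 0, beta = x, alpha2 = T: this shows that H
   divides G, so that z = xi(F). The coefficient of alpha2^r in xi(F) is
   F_r(t^a + alpha1 beta) / alpha1^r, whence the criterion applies to each F_r. *)

From HB Require Import structures.
Require Import Defs.
From mathcomp Require Import all_boot all_order all_algebra.
From mathcomp Require Import mpoly.
From mathcomp Require Import ring.
Set Implicit Arguments.
Unset Strict Implicit.
Unset Printing Implicit Defensive.
Import GRing.Theory.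
Local Open Scope ring_scope.

(** * Powers of a prime ideal, before and after localization *)

Section LocalizedPowers.
Variables (A : idomainType) (P : prime_idealr A).

Lemma ideal_pow0 r : ideal_pow P r 0.
Proof.
by exists 0, (fun=> 0), (fun _ _ => 0); split=> [[]|]; rewrite ?big_ord0.
Qed.

Lemma ideal_powD r f g :
  ideal_pow P r f -> ideal_pow P r g -> ideal_pow P r (f + g).
Proof.
move=> [n1 [c1 [g1 [Pg1 ->]]]] [n2 [c2 [g2 [Pg2 ->]]]].
exists (n1 + n2)%N,
  (fun i => match split i with inl j => c1 j | inr j => c2 j end),
  (fun i => match split i with inl j => g1 j | inr j => g2 j end).
split=> [i j|]; first by case: (split i).
rewrite big_split_ord; congr (_ + _); apply: eq_bigr => i _.
  by rewrite (unsplitK (inl i)).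
by rewrite (unsplitK (inr i)).
Qed.

Lemma ideal_pow_prod r (c : A) (g : 'I_r -> A) :
  (forall j, g j \in P) -> ideal_pow P r (c * \prod_(j < r) g j).
Proof.
by move=> Pg; exists 1, (fun=> c), (fun=> g); split=> //; rewrite big_ord1.
Qed.

Lemma ideal_pow_deg0 f : ideal_pow P 0 f.
Proof.
have Pg (j : 'I_0) : (0 : A) \in P by case: j.
by have := ideal_pow_prod f Pg; rewrite big_ord0 mulr1.
Qed.

Lemma ideal_pow1 f : f \in P -> ideal_pow P 1 f.
Proof.
by move=> Pf; have := ideal_pow_prod 1 (fun _ : 'I_1 => Pf); rewrite big_ord1 mul1r.
Qed.

Lemma ideal_powM r s f g :
  ideal_pow P r f -> ideal_pow P s g -> ideal_pow P (r + s) (f * g).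
Proof.
move=> [n1 [c1 [g1 [Pg1 ->]]]] [n2 [c2 [g2 [Pg2 ->]]]]; rewrite mulr_suml.
elim/big_ind: _ => [||i _]; [exact: ideal_pow0 | exact: ideal_powD|].
rewrite mulr_sumr.
elim/big_ind: _ => [||j _]; [exact: ideal_pow0 | exact: ideal_powD|].
pose h (l : 'I_(r + s)) := match split l with inl u => g1 i u | inr u => g2 j u end.
have Ph l : h l \in P by rewrite /h; case: (split l).
have := ideal_pow_prod (c1 i * c2 j) Ph.
rewrite big_split_ord /= /h.
under eq_bigr do rewrite (unsplitK (inl _)).
under [X in _ * (_ * X)]eq_bigr do rewrite (unsplitK (inr _)).
by rewrite mulrACA.
Qed.

Lemma ideal_powMl r c f : ideal_pow P r f -> ideal_pow P r (c * f).
Proof. exact: (ideal_powM (ideal_pow_deg0 c)). Qed.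

Lemma leq_ideal_pow r s f : (r <= s)%N -> ideal_pow P s f -> ideal_pow P r f.
Proof.
move=> /subnK <- [n [c [g [Pg ->]]]].
elim/big_ind: _ => [||i _]; [exact: ideal_pow0 | exact: ideal_powD|].
(* The first [s - r] factors are absorbed into the coefficient. *)
rewrite big_split_ord mulrA; exact: ideal_pow_prod.
Qed.

(** The ideal $P^rA_P$ again, with one common denominator in place of the sums of [localized_ideal];
    [symbolic_powP] compares the two forms. *)
Definition frac_ideal_pow r (y : {fraction A}) : Prop :=
  exists f s, [/\ ideal_pow P r f, s \notin P & y = f%:F / s%:F].

Lemma notin_prime_idealM s t : s \notin P -> t \notin P -> s * t \notin P.
Proof. by move=> Ps Pt; rewrite prime_idealrM negb_or Ps. Qed.

Lemma tofrac_neq0 s : s \notin P -> s%:F != 0.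
Proof. by rewrite tofrac_eq0; apply: contraNneq => ->; apply: rpred0. Qed.

Lemma frac_ideal_pow_num r f : ideal_pow P r f -> frac_ideal_pow r f%:F.
Proof.
by move=> Pf; exists f, 1; rewrite idealr1 tofrac1 divr1.
Qed.

Lemma frac_ideal_powD r y z :
  frac_ideal_pow r y -> frac_ideal_pow r z -> frac_ideal_pow r (y + z).
Proof.
move=> [f [s [Pf Ps ->]]] [g [t [Pg Pt ->]]]; exists (t * f + s * g), (s * t).
split; [by apply: ideal_powD; apply: ideal_powMl | exact: notin_prime_idealM |].
by rewrite addf_div ?tofrac_neq0 // tofracD !tofracM [t%:F * _]mulrC [s%:F * g%:F]mulrC.
Qed.

Lemma frac_ideal_powM r q y z :
  frac_ideal_pow r y -> frac_ideal_pow q z -> frac_ideal_pow (r + q) (y * z).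
Proof.
move=> [f [s [Pf Ps ->]]] [g [t [Pg Pt ->]]]; exists (f * g), (s * t).
split; [exact: ideal_powM | exact: notin_prime_idealM |].
by rewrite !tofracM mulf_div.
Qed.

Lemma leq_frac_ideal_pow r q y :
  (r <= q)%N -> frac_ideal_pow q y -> frac_ideal_pow r y.
Proof.
by move=> le_rq [f [s [Pf Ps ->]]]; exists f, s; split=> //; apply: leq_ideal_pow Pf.
Qed.

Lemma frac_ideal_pow_sum r I (l : seq I) (Q : pred I) (F : I -> {fraction A}) :
  (forall i, Q i -> frac_ideal_pow r (F i)) ->
  frac_ideal_pow r (\sum_(i <- l | Q i) F i).
Proof.
move=> PF; elim/big_ind: _ => //; last exact: frac_ideal_powD.
by rewrite -tofrac0; apply/frac_ideal_pow_num/ideal_pow0.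
Qed.

Lemma symbolic_powP r f : symbolic_pow P r f <-> frac_ideal_pow r f%:F.
Proof.
split=> [[n [u [g [ug ->]]]]|[g [s [Pg Ps fE]]]].
  apply: frac_ideal_pow_sum => i _; have [[h [s [Ps ->]]] Pg] := ug i.
  apply: (@frac_ideal_powM 0 r); last exact: frac_ideal_pow_num.
  by exists h, s; split=> //; apply: ideal_pow_deg0.
exists 1, (fun=> 1 / s%:F), (fun=> g); split=> [_|]; last first.
  by rewrite big_ord1 fE mul1r mulrC.
by split=> //; exists 1, s; rewrite tofrac1.
Qed.

Lemma symbolic_pow_num r f :
  symbolic_pow P r f -> exists2 s, s \notin P & ideal_pow P r (s * f).
Proof.
case/symbolic_powP=> g [s [Pg Ps fE]]; exists s => //.
suff -> : s * f = g by [].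
by apply/eqP; rewrite -tofrac_eq tofracM fE mulrC divfK ?tofrac_neq0.
Qed.

(* [F] lies in the Rees algebra of [P A_P], inside Frac(A)[X]. *)
Definition rees_coef (F : {poly {fraction A}}) : Prop :=
  forall j, frac_ideal_pow j F`_j.

Lemma rees_coefC c : frac_ideal_pow 0 c -> rees_coef c%:P.
Proof.
move=> Pc [|j]; rewrite coefC //=.
by rewrite -tofrac0; apply/frac_ideal_pow_num/ideal_pow0.
Qed.

Lemma rees_coefXM c : frac_ideal_pow 1 c -> rees_coef ('X * c%:P).
Proof.
move=> Pc [|[|j]]; rewrite coefXM ?coefC //= -tofrac0;
  exact/frac_ideal_pow_num/ideal_pow0.
Qed.

Lemma rees_coefD F G : rees_coef F -> rees_coef G -> rees_coef (F + G).
Proof. by move=> PF PG j; rewrite coefD; apply: frac_ideal_powD. Qed.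

Lemma rees_coefM F G : rees_coef F -> rees_coef G -> rees_coef (F * G).
Proof.
move=> PF PG j; rewrite coefM; apply: frac_ideal_pow_sum => i _.
by have := frac_ideal_powM (PF i) (PG (j - i)%N); rewrite subnKC // leq_ord.
Qed.

End LocalizedPowers.

(** * Evaluation of multivariate polynomials *)

Lemma mmap_closed n (R S : comNzRingType) (f : {rmorphism R -> S})
    (h : 'I_n -> S) (Q : S -> Prop) (p : {mpoly R[n]}) :
  (forall c, Q (f c)) -> (forall i, Q (h i)) ->
  (forall x y, Q x -> Q y -> Q (x + y)) ->
  (forall x y, Q x -> Q y -> Q (x * y)) -> Q (mmap f h p).
Proof.
move=> Qf Qh QD QM; have Q1 : Q 1 by rewrite -(rmorph1 f).
rewrite /mmap; apply: (big_ind Q) => [||mo _]; [by rewrite -(rmorph0 f) | exact: QD |].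
apply: (QM) => //; rewrite /mmap1; apply: (big_ind Q) => [||i _].
- exact: Q1.
- exact: QM.
- by elim: (mo i) => [|e IH]; rewrite ?expr0 // exprS; apply: QM.
Qed.

(** With [eq_mmap] and [mmap_id], this reduces an equality of ring morphisms on polynomials to
    constants and variables. *)
Lemma rmorph_mmap n (R S S' : comNzRingType) (f : {rmorphism R -> S})
    (h : 'I_n -> S) (g : {rmorphism S -> S'}) p :
  g (mmap f h p) = mmap (g \o f) (g \o h) p.
Proof.
rewrite /mmap rmorph_sum; apply: eq_bigr => mo _; rewrite rmorphM /=.
congr (_ * _); rewrite /mmap1 rmorph_prod; apply: eq_bigr => i _.
by rewrite rmorphXn.
Qed.

Lemma eq_mmap n (R S : comNzRingType) (f g : R -> S) (h h' : 'I_n -> S) p :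
  f =1 g -> h =1 h' -> mmap f h p = mmap g h' p.
Proof.
move=> fg hh; rewrite /mmap; apply: eq_bigr => mo _; rewrite fg; congr (_ * _).
by apply: mmap1_eq.
Qed.

Lemma mmap_id n (R : comNzRingType) (p : {mpoly R[n]}) :
  mmap (@mpolyC n R) (fun i => 'X_i) p = p.
Proof.
rewrite {2}[p]mpolyE /mmap; apply: eq_bigr => mo _.
by rewrite mmap1_id mul_mpolyC.
Qed.

Lemma horner_line1 (R : comNzRingType) (x y : R) :
  (x%:P + 'X * y%:P).[1] = x + y.
Proof. by rewrite hornerD hornerM hornerX !hornerC mul1r. Qed.

(** * Divisibility by powers of the variable *)

Lemma polyXn_mulI (R : idomainType) (p q : {poly R}) n :
  'X^n * p = 'X^n * q -> p = q.
Proof. by apply: mulfI; rewrite expf_neq0 ?polyX_eq0. Qed.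

(** The variable is prime and does not divide [S], so its powers can be split off [F] one at a
    time. *)
Lemma Xn_cancel (R : idomainType) (S F q : {poly R}) r :
  S * F = 'X^r * q -> S`_0 != 0 -> exists q', F = 'X^r * q'.
Proof.
move=> + S0; elim: r q => [|r IH] q SF; first by exists F; rewrite mul1r.
have [q' Fq'] : exists q', F = 'X^r * q'.
  by apply: (IH ('X * q)); rewrite mulrA -exprSr.
have Sq' : S * q' = 'X * q.
  by apply: (@polyXn_mulI _ _ _ r); rewrite mulrCA -Fq' SF exprSr mulrA.
have q'0 : q'`_0 = 0.
  have /eqP : (S * q')`_0 = 0 by rewrite Sq' coefXM.
  by rewrite coef0M mulf_eq0 (negPf S0) => /eqP.
exists (drop_poly 1 q'); rewrite Fq' exprSr -mulrA; congr (_ * _).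
by apply/polyP => -[|j]; rewrite coefXM //= coef_drop_poly addn1.
Qed.

(** * Taylor expansion along the curve and symbolic powers *)

Section Taylor.
Variables (k : fieldType) (m : nat).

(** This is $f(t^e+\alpha_1\beta)$: the outer variable is $\alpha_1$, the inner one is $t$, and
    ['X_i] in the coefficients stands for $\beta_i$. The exponents are a parameter because both [a]
    and its quotient by a common divisor occur. *)
Definition taylor (e : 'I_m -> nat) : {mpoly k[m]} -> {poly {poly {mpoly k[m]}}} :=
  mmap (polyC \o polyC \o @mpolyC m k)
       (fun i => ('X^(e i))%:P + 'X * ('X_i)%:P%:P).

HB.instance Definition _ e := GRing.RMorphism.copy (taylor e)
  (mmap (polyC \o polyC \o @mpolyC m k)
       (fun i => ('X^(e i))%:P + 'X * ('X_i)%:P%:P)).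

Variable a : 'I_m -> nat.

Lemma taylor_coef0 f : (taylor a f)`_0 = map_poly (@mpolyC m k) (phi a f).
Proof.
rewrite -[LHS]/(coefp 0 _) /taylor /phi !rmorph_mmap; apply: eq_mmap => [c|i] /=.
  by rewrite !coefC map_polyC.
by rewrite coefD coefXM coefC addr0 map_polyXn.
Qed.

Lemma taylor_coef0_eq0 f : ((taylor a f)`_0 == 0) = (f \in curve_ideal k a).
Proof.
by rewrite taylor_coef0 map_poly_eq0.
Qed.

(** Each of the [r] factors from the ideal has zero constant term by [taylor_coef0_eq0], hence
    contributes one factor ['X]. *)
Lemma taylor_ideal_pow r f :
  ideal_pow (curve_ideal k a) r f -> exists q, taylor a f = 'X^r * q.
Proof.
have XdvdP g : coefp 0 g = 0 -> exists q : {poly {poly {mpoly k[m]}}}, g = 'X * q.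
  move=> g0; exists (drop_poly 1 g); apply/polyP => -[|j].
    by rewrite coefXM.
  by rewrite coefXM coef_drop_poly addn1.
move=> [n [c [g [Pg ->]]]]; rewrite rmorph_sum.
elim/big_ind: _ => [|_ _ [q1 ->] [q2 ->]|i _]; first by exists 0; rewrite mulr0.
  by exists (q1 + q2); rewrite mulrDr.
rewrite rmorphM rmorph_prod /=.
have: exists q : {poly {poly {mpoly k[m]}}}, \prod_(j < r) taylor a (g i j) = 'X^r * q.
  move: (g i) (Pg i) => {c g Pg}; elim: r => [|r IH] h Ph.
    by exists 1; rewrite big_ord0 mulr1.
  rewrite big_ord_recr /=; case: (IH (fun j => h (widen_ord (leqnSn r) j))) => // q ->.
  have /eqP/XdvdP[q' ->] : (taylor a (h ord_max))`_0 == 0 by rewrite taylor_coef0_eq0.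
  by exists (q * q'); rewrite exprSr mulrACA.
by case=> q ->; exists (taylor a (c i) * q); rewrite mulrCA.
Qed.

Lemma taylor_symbolic_pow r f :
  symbolic_pow (curve_ideal k a) r f -> exists q, taylor a f = 'X^r * q.
Proof.
case/symbolic_pow_num=> s Ps /taylor_ideal_pow[q]; rewrite rmorphM => sf.
by apply: (Xn_cancel sf); rewrite taylor_coef0_eq0.
Qed.

(** Euclid's algorithm on exponents, starting from ['X_i / 1] for the first index. The fraction
    [U / V] stands for $t^d$; as long as some [a i] is not a multiple of [d], it is replaced by one
    standing for a smaller positive power. *)
Lemma curve_gcd_monomials : (0 < m)%N -> (forall i, (0 < a i)%N) ->
  exists d (U V : {mpoly k[m]}) e, [/\ (0 < d)%N, forall i, (d %| a i)%N,
    phi a U = 'X^(e + d) :> {poly k} & phi a V = 'X^e].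
Proof.
move=> m_gt0 a_gt0.
have phiX i : phi a 'X_i = 'X^(a i) :> {poly k} by rewrite /phi mmapX mmap1U.
suff H d : (0 < d)%N -> forall (U V : {mpoly k[m]}) e, phi a U = 'X^(e + d) :> {poly k} ->
    phi a V = 'X^e -> exists d (U V : {mpoly k[m]}) e,
      [/\ (0 < d)%N, forall i, (d %| a i)%N,
      phi a U = 'X^(e + d) :> {poly k} & phi a V = 'X^e].
  apply: (H _ (a_gt0 (Ordinal m_gt0)) ('X_(Ordinal m_gt0)) 1 0) => //.
  by rewrite rmorph1.
elim/ltn_ind: d => d IH d_gt0 U V e phiU phiV.
case: (boolP [forall i, d %| a i]%N) => [/forallP|/forallPn[i ndvd]].
  by exists d, U, V, e.
pose q := (a i %/ d)%N.
(* The new fraction is $x_i/(U/V)^q$, which stands for $t^{a_i-dq}$. *)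
apply: (IH (a i %% d)%N _ _ ('X_i * V ^+ q) (U ^+ q) ((e + d) * q)%N).
- by rewrite ltn_mod.
- by rewrite lt0n.
- rewrite rmorphM rmorphXn /= phiX phiV -exprM -exprD; congr ('X^_).
  by rewrite mulnDl [(d * q)%N]mulnC -addnA -divn_eq addnC.
- by rewrite rmorphXn /= phiU -exprM.
Qed.

(* If [u] in [A_P] lifts [t^d], where [d] divides every [a i], then
   [f = \sum_I (D_I f)(u^b) (x - u^b)^I] with [b i = a i / d]. The Hasse
   derivative [D_I f] vanishes at [u^b] as soon as it vanishes at [t^a]. *)
Lemma symbolic_pow_taylor r f : (0 < m)%N -> (forall i, (0 < a i)%N) ->
  (exists q, taylor a f = 'X^r * q) -> symbolic_pow (curve_ideal k a) r f.
Proof.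
move=> m_gt0 a_gt0 [q fq]; apply/symbolic_powP.
have [d [U [V [e [d_gt0 dvd_d phiU phiV]]]]] := curve_gcd_monomials m_gt0 a_gt0.
pose P : prime_idealr _ := curve_ideal k a; pose b i := (a i %/ d)%N.
have PV : V \notin P by rewrite inE phiV expf_neq0 ?polyX_eq0.
pose u := U%:F / V%:F.
have Pu : frac_ideal_pow P 0 u.
  by exists U, V; split=> //; apply: ideal_pow_deg0.
have PuX n : frac_ideal_pow P 0 (u ^+ n).
  elim: n => [|n IH]; last by rewrite exprS; apply: (@frac_ideal_powM _ P 0 0).
  by rewrite expr0 -tofrac1; apply/frac_ideal_pow_num/ideal_pow_deg0.
pose w i := ('X_i)%:F - u ^+ b i.
(* After multiplication by [V ^+ b i], both terms have the same image under [phi], since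
   [d * b i = a i]. *)
have Pw i : frac_ideal_pow P 1 (w i).
  exists ('X_i * V ^+ b i - U ^+ b i), (V ^+ b i); split.
  - apply: ideal_pow1; rewrite inE rmorphB rmorphM !rmorphXn /= phiU phiV.
    rewrite {1}/phi mmapX mmap1U -!exprM -exprD mulnDl [(d * _)%N]mulnC divnK //.
    by rewrite addnC subrr.
  - by rewrite inE rmorphXn /= phiV !expf_neq0 ?polyX_eq0.
  - have V0 : V%:F ^+ b i != 0 by rewrite expf_neq0 ?(tofrac_neq0 PV).
    by rewrite /w /u tofracB tofracM !tofracXn mulrBl mulfK // expr_div_n.
(* The specialization $t=u$, $\beta=w$. It turns [taylor b f] into $F=f(u^b+Xw)$, whose value at
   $X=1$ is $f$ and whose coefficient of $X^j$ lies in $P^jA_P$. *)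
pose sg : {rmorphism {poly {mpoly k[m]}} -> {fraction {mpoly k[m]}}} :=
  horner_eval u \o map_poly (mmap (@FracField.tofrac _ \o @mpolyC m k) w).
pose F := map_poly sg (taylor b f).
have FE : F = mmap (polyC \o (@FracField.tofrac _ \o @mpolyC m k))
              (fun i => (u ^+ b i)%:P + 'X * (w i)%:P) f.
  rewrite /F /taylor rmorph_mmap; apply: eq_mmap => [c|i] /=.
    by rewrite map_polyC /sg /= map_polyC /= /horner_eval hornerC mmapC.
  rewrite rmorphD rmorphM /= !map_polyC map_polyX /sg /= map_polyXn map_polyC /=.
  by rewrite /horner_eval hornerXn hornerC mmapX mmap1U.
have F1 : F.[1] = f%:F.
  rewrite FE -[LHS]/(horner_eval 1 _) rmorph_mmap -[in RHS](mmap_id f) rmorph_mmap.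
  apply: eq_mmap => [c|i] /=; first by rewrite /horner_eval hornerC.
  by rewrite /horner_eval horner_line1 addrC subrK.
have PF : rees_coef P F.
  rewrite FE; apply: (mmap_closed (Q := rees_coef P)) => [c|i||].
  - exact/rees_coefC/frac_ideal_pow_num/ideal_pow_deg0.
  - by apply: rees_coefD; [apply: rees_coefC | apply: rees_coefXM].
  - exact: rees_coefD.
  - exact: rees_coefM.
(* Replacing $t$ by $t^d$ turns $t^{b_i}$ into $t^{a_i}$. As $d>0$ this substitution is injective,
   so the coefficients that vanish for [a] vanish for [b] as well. *)
have Tab : taylor a f = map_poly (comp_poly 'X^d) (taylor b f).
  rewrite /taylor rmorph_mmap; apply: eq_mmap => [c|i] /=.
    by rewrite map_polyC /= comp_polyC.
  rewrite rmorphD rmorphM /= !map_polyC map_polyX /= comp_polyC comp_Xn_poly.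
  by rewrite -exprM mulnC divnK.
have Flow j : (j < r)%N -> F`_j = 0.
  move=> lt_jr; suff Tb0 : (taylor b f)`_j = 0.
    by rewrite coef_map Tb0; apply: (rmorph0 sg).
  apply/eqP; rewrite -(@comp_poly_eq0 _ _ 'X^d) ?size_polyXn //; apply/eqP.
  by rewrite -[LHS](coef_map (comp_poly 'X^d)) -Tab fq coefXnM lt_jr.
rewrite -F1 horner_coef; apply: frac_ideal_pow_sum => j _; rewrite expr1n mulr1.
case: (ltnP j r) => [/Flow->|le_rj]; last exact: leq_frac_ideal_pow (PF j).
by rewrite -tofrac0; apply/frac_ideal_pow_num/ideal_pow0.
Qed.

End Taylor.

(** * Identities between fractions in a field *)

Lemma rmorph_subf_div (R : comNzRingType) (K : fieldType)
    (f : {rmorphism R -> K}) (x y z t : R) : f y != 0 -> f t != 0 ->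
  f x / f y - f z / f t = f (x * t - z * y) / f (y * t).
Proof. by move=> y0 t0; rewrite -mulNr addf_div // mulNr rmorphB !rmorphM. Qed.

Lemma rmorph_divf_div (R : comNzRingType) (K : fieldType)
    (f : {rmorphism R -> K}) (x y z t : R) :
  f x / f y / (f z / f t) = f (x * t) / f (y * z).
Proof. by rewrite invf_div mulf_div !rmorphM. Qed.

Lemma expr_div_cancel (K : fieldType) (x y z : K) n : x != 0 ->
  x ^+ n * y * (z / x) ^+ n = y * z ^+ n.
Proof.
move=> x0; rewrite expr_div_n [x ^+ n * y]mulrC -mulrA; congr (_ * _).
by rewrite mulrC divfK ?expf_neq0.
Qed.

(** Horner step of [xi_clear_denom], with $x=\alpha_1$ and $z=\alpha_2$: one more factor $T$ costs
    one more power of $\alpha_1$. *)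
Lemma expr_clear_denom (K : fieldType) (x y z w : K) n : x != 0 ->
  x ^+ n.+1 * (y * (z / x) + w) = x ^+ n * y * z + x ^+ n.+1 * w.
Proof. by move=> x0; rewrite exprS; field. Qed.

(** * Evaluation of polynomials in $\alpha_1,\alpha_2,\beta,t$ *)

Section Ambient.
Variables (k : fieldType) (m : nat).

Notation X1 := ('X_(lshift 1 (lshift m 0)) : ambient_poly k m).
Notation X2 := ('X_(lshift 1 (lshift m 1)) : ambient_poly k m).
Notation Xb i := ('X_(lshift 1 (rshift 2 i)) : ambient_poly k m).
Notation Xt := ('X_(rshift (2 + m) 0) : ambient_poly k m).

Section Eval.
Variables (S : comNzRingType) (iota : {rmorphism k -> S}).
Variables (x1 x2 : S) (y : 'I_m -> S) (t : S).

Definition ambient_point (i : 'I_(2 + m + 1)) : S :=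
  match split i with
  | inl j => match split j with
             | inl l => if l == 0 then x1 else x2
             | inr l => y l
             end
  | inr _ => t
  end.

Definition ambient_eval : ambient_poly k m -> S := mmap iota ambient_point.

HB.instance Definition _ :=
  GRing.RMorphism.copy ambient_eval (mmap iota ambient_point).

Lemma ambient_evalC c : ambient_eval c%:MP = iota c.
Proof. exact: mmapC. Qed.

Lemma ambient_eval_alpha1 : ambient_eval X1 = x1.
Proof.
rewrite /ambient_eval mmapX mmap1U /ambient_point.
by rewrite (unsplitK (inl _)) (unsplitK (inl _)).
Qed.

Lemma ambient_eval_alpha2 : ambient_eval X2 = x2.
Proof.
rewrite /ambient_eval mmapX mmap1U /ambient_point.
by rewrite (unsplitK (inl _)) (unsplitK (inl _)).
Qed.

Lemma ambient_eval_beta i : ambient_eval (Xb i) = y i.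
Proof.
rewrite /ambient_eval mmapX mmap1U /ambient_point.
by rewrite (unsplitK (inl _)) (unsplitK (inr _)).
Qed.

Lemma ambient_eval_t : ambient_eval Xt = t.
Proof. by rewrite /ambient_eval mmapX mmap1U /ambient_point (unsplitK (inr _)). Qed.

Definition ambient_evalE := (ambient_evalC, ambient_eval_alpha1,
  ambient_eval_alpha2, ambient_eval_beta, ambient_eval_t).

End Eval.

(** * Specializations, clearing of denominators and injectivity of [xi] *)

Variable a : 'I_m -> nat.

(** The restriction of [xi] to $k[x]$, which has no denominators and so takes values in the
    polynomial ring. *)
Definition xi0 : {mpoly k[m]} -> ambient_poly k m :=
  mmap (@mpolyC (2 + m + 1) k) (fun i => X1 * Xb i + Xt ^+ a i).

HB.instance Definition _ := GRing.RMorphism.copy xi0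
  (mmap (@mpolyC (2 + m + 1) k) (fun i => X1 * Xb i + Xt ^+ a i)).

Lemma tofrac_xi0 f : (xi0 f)%:F = mmap ambient_const (xi_var k a) f.
Proof.
rewrite /xi0 rmorph_mmap; apply: eq_mmap => [c|i] //=.
by rewrite tofracD tofracM tofracXn.
Qed.

Lemma xi_polyC f : xi k a f%:P = (xi0 f)%:F.
Proof. by rewrite /xi map_polyC hornerC tofrac_xi0. Qed.

(** Renames the variables of [taylor] to $\alpha_1$, $t$, $\beta$, so that divisibility by ['X^r]
    becomes divisibility by $\alpha_1^r$. *)
Definition taylor_to_ambient : {poly {poly {mpoly k[m]}}} -> ambient_poly k m :=
  horner_eval X1 \o map_poly (horner_eval Xt \o
    map_poly (mmap (@mpolyC (2 + m + 1) k) (fun i => Xb i))).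

HB.instance Definition _ := GRing.RMorphism.copy taylor_to_ambient
  (horner_eval X1 \o map_poly (horner_eval Xt \o
    map_poly (mmap (@mpolyC (2 + m + 1) k) (fun i => Xb i)))).

Lemma taylor_to_ambientX : taylor_to_ambient 'X = X1.
Proof. by rewrite /taylor_to_ambient /= map_polyX /horner_eval hornerX. Qed.

Lemma taylor_to_ambientC p :
  taylor_to_ambient p%:P =
    (map_poly (mmap (@mpolyC (2 + m + 1) k) (fun i => Xb i)) p).[Xt].
Proof. by rewrite /taylor_to_ambient /= map_polyC /horner_eval hornerC. Qed.

Lemma taylor_to_ambient_taylor f : taylor_to_ambient (taylor a f) = xi0 f.
Proof.
rewrite /taylor rmorph_mmap; apply: eq_mmap => [c|i] /=.
  by rewrite taylor_to_ambientC map_polyC hornerC /= mmapC.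
rewrite rmorphD rmorphM /= taylor_to_ambientX !taylor_to_ambientC.
by rewrite map_polyXn hornerXn map_polyC hornerC /= mmapX mmap1U addrC.
Qed.

(** Setting $\alpha_1=1$ removes the denominators of [xi], and $t=0$ kills the $t^{a_i}$ when the
    exponents are positive; what remains inverts [xi]. *)
Definition to_xT : ambient_poly k m -> {poly {mpoly k[m]}} :=
  ambient_eval (polyC \o @mpolyC m k) 1 'X (fun i => ('X_i)%:P) 0.

HB.instance Definition _ := GRing.RMorphism.on to_xT.

(** The outermost variable is $\alpha_2$, so that the coefficients lie in the target ring of
    [taylor]. *)
Definition to_taylor : ambient_poly k m -> {poly {poly {poly {mpoly k[m]}}}} :=
  ambient_eval (polyC \o (polyC \o (polyC \o @mpolyC m k))) 'X%:P 'X
    (fun i => ('X_i)%:P%:P%:P) 'X%:P%:P.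

HB.instance Definition _ := GRing.RMorphism.on to_taylor.

Lemma to_xT_xi0 f : (forall i, (0 < a i)%N) -> to_xT (xi0 f) = f%:P.
Proof.
move=> a_gt0; rewrite -[in RHS](mmap_id f) /xi0 !rmorph_mmap.
apply: eq_mmap => [c|i] /=; first by rewrite /to_xT ambient_evalE.
rewrite rmorphD rmorphM rmorphXn /= /to_xT !ambient_evalE mul1r.
by rewrite expr0n gtn_eqF ?addr0.
Qed.

Lemma to_taylor_xi0 f : to_taylor (xi0 f) = (taylor a f)%:P.
Proof.
rewrite /taylor /xi0 !rmorph_mmap.
apply: eq_mmap => [c|i] /=; first by rewrite /to_taylor ambient_evalE.
rewrite rmorphD rmorphM rmorphXn /= /to_taylor !ambient_evalE.
by rewrite addrC polyCD polyCM !polyC_exp.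
Qed.

Lemma alpha1_neq0 : alpha1 != 0 :> ambient_field k m.
Proof.
rewrite tofrac_eq0; apply/eqP => /(congr1 to_xT)/eqP.
by rewrite rmorph0 /to_xT ambient_evalE oner_eq0.
Qed.

(** Induction on the Horner form of [F]. The coefficient of $\alpha_2^j$ in [q] should be
    $\alpha_1^{N-j}F_j(t^a+\alpha_1\beta)$; the factor ['X^j] on the left avoids the subtraction
    $N-j$. *)
Lemma xi_clear_denom F : (forall i, (0 < a i)%N) -> exists N q,
  [/\ alpha1 ^+ N * xi k a F = q%:F, to_xT q = F &
      forall j, (to_taylor q)`_j * 'X^j = 'X^N * taylor a F`_j].
Proof.
move=> a_gt0; elim/poly_ind: F => [|F c [N [q [Fq psi_q theta_q]]]].
  exists 0%N, 0; split; first by rewrite rmorph0 mulr0 tofrac0.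
    exact: rmorph0.
  move=> j; rewrite coef0 (rmorph0 (taylor a)) mulr0 (rmorph0 to_taylor).
  by rewrite (coef0 {poly {poly {mpoly k[m]}}}) mul0r.
exists N.+1, (q * X2 + X1 ^+ N.+1 * xi0 c); split.
- rewrite (rmorphD (xi k a)) (rmorphM (xi k a)) /= xi_polyC xi_T.
  rewrite expr_clear_denom ?alpha1_neq0 // Fq.
  by rewrite tofracD !tofracM tofracXn.
- rewrite (rmorphD to_xT) !(rmorphM to_xT) (rmorphXn to_xT) /= psi_q to_xT_xi0 //.
  by rewrite /to_xT !ambient_evalE expr1n mul1r.
- rewrite (rmorphD to_taylor) !(rmorphM to_taylor) (rmorphXn to_taylor) /=.
  rewrite to_taylor_xi0 /to_taylor !ambient_evalE.
  rewrite -polyC_exp -polyCM => -[|j].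
    by rewrite !coefD !coefMX !coefC !add0r mulr1.
  rewrite !coefD !coefMX !coefC !addr0 /= !exprSr mulrA theta_q.
  by rewrite mulrAC.
Qed.

(** The cleared forms of both images agree up to powers of $\alpha_1$, and [to_xT], which sends
    $\alpha_1$ to 1, recovers [F] and [G] from them. *)
Lemma xi_inj : (forall i, (0 < a i)%N) -> injective (xi k a).
Proof.
move=> a_gt0 F G eqFG.
have [N [p [Fp psi_p _]]] := xi_clear_denom F a_gt0.
have [M [q [Gq psi_q _]]] := xi_clear_denom G a_gt0.
have /(congr1 to_xT) : X1 ^+ M * p = X1 ^+ N * q.
  apply/eqP; rewrite -tofrac_eq !tofracM !tofracXn -Fp -Gq eqFG.
  by rewrite mulrCA.
by rewrite !rmorphM !rmorphXn /= psi_p psi_q /to_xT !ambient_evalE !expr1n !mul1r.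
Qed.

(** In each degree $i$, the factor $\alpha_1^i$ of $F_i(t^a+\alpha_1\beta)$ cancels the denominator
    of $(\alpha_2/\alpha_1)^i$. *)
Lemma symbolic_rees_ambient (F : {poly {mpoly k[m]}}) :
  symbolic_rees (curve_ideal k a) F -> exists p, xi k a F = p%:F.
Proof.
move=> PF; have tF i : exists p, xi k a ((F`_i)%:P * 'X^i) = p%:F.
  have [q Fq] := taylor_symbolic_pow (PF i).
  exists (taylor_to_ambient q * X2 ^+ i).
  rewrite (rmorphM (xi k a)) (rmorphXn (xi k a)) /= xi_polyC xi_T.
  rewrite -taylor_to_ambient_taylor Fq (rmorphM taylor_to_ambient).
  rewrite (rmorphXn taylor_to_ambient) /= taylor_to_ambientX !tofracM !tofracXn.
  exact: (expr_div_cancel _ _ _ alpha1_neq0).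
rewrite -[F]coefK poly_def rmorph_sum.
elim/big_ind: _ => [|_ _ [p ->] [q ->]|i _].
- by exists 0; rewrite tofrac0.
- by exists (p + q); rewrite tofracD.
- by rewrite -mul_polyC; apply: tF.
Qed.

Lemma ambient_symbolic_rees (F : {poly {mpoly k[m]}}) p :
  (0 < m)%N -> (forall i, (0 < a i)%N) ->
  xi k a F = p%:F -> symbolic_rees (curve_ideal k a) F.
Proof.
move=> m_gt0 a_gt0 Fp r; apply: symbolic_pow_taylor => //.
have [N [q [Fq _ /(_ r)]]] := xi_clear_denom F a_gt0.
have -> : q = X1 ^+ N * p.
  by apply/eqP; rewrite -tofrac_eq tofracM tofracXn -Fq Fp.
(* In the coefficient of $\alpha_2^r$, the factor $\alpha_1^N$ now occurs on both sides and
   cancels. *)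
rewrite rmorphM rmorphXn /= {1}/to_taylor ambient_evalE -polyC_exp coefCM -mulrA.
by move/polyXn_mulI <-; exists (to_taylor p)`_r; apply: mulrC.
Qed.

(** * The generated subfield as the fractions of the image of [xi] *)

Notation gens := (rcons [seq alpha1 * beta i + tvar ^+ a i | i : 'I_m]
  (alpha2 / alpha1 : ambient_field k m)).

Lemma gen_subfield_fraction z : (forall i, (0 < a i)%N) ->
  gen_subfield ambient_const gens z ->
  exists G H : {poly {mpoly k[m]}}, H != 0 /\ z = xi k a G / xi k a H.
Proof.
move=> a_gt0; have xi_neq0 (H : {poly {mpoly k[m]}}) : H != 0 -> xi k a H != 0.
  by rewrite -(inj_eq (xi_inj a_gt0)) rmorph0.
elim=> {z} [c|z|z1 z2 _ [G1 [H1 [H10 ->]]] _ [G2 [H2 [H20 ->]]]|].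
- by exists c%:MP%:P, 1; rewrite oner_eq0 rmorph1 divr1 xiC.
- rewrite mem_rcons inE => /orP[/eqP->|/mapP[i _ ->]].
    by exists 'X, 1; rewrite oner_eq0 rmorph1 divr1 xi_T.
  by exists ('X_i)%:P, 1; rewrite oner_eq0 rmorph1 divr1 xi_x.
- exists (G1 * H2 - G2 * H1), (H1 * H2); rewrite mulf_neq0 //; split=> //.
  exact: (@rmorph_subf_div {poly {mpoly k[m]}} (ambient_field k m) (xi k a)
    _ _ _ _ (xi_neq0 _ H10) (xi_neq0 _ H20)).
- move=> z1 z2 _ [G1 [H1 [H10 ->]]] _ [G2 [H2 [H20 ->]]].
  (* If the divisor is 0, the quotient is 0 by convention and is written as [0 / 1]. *)
  have [->|G20] := eqVneq G2 0.
    by exists 0, 1; rewrite oner_eq0 !rmorph0 !mul0r invr0 mulr0.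
  exists (G1 * H2), (H1 * G2); rewrite mulf_neq0 //; split=> //.
  exact: (@rmorph_divf_div {poly {mpoly k[m]}} (ambient_field k m) (xi k a)).
Qed.

Lemma gen_subfield_xi F : gen_subfield ambient_const gens (xi k a F).
Proof.
have K0 : gen_subfield ambient_const gens 0.
  by rewrite -(rmorph0 ambient_const); apply: gen_subfield_base.
have K1 : gen_subfield ambient_const gens 1.
  by rewrite -(rmorph1 ambient_const); apply: gen_subfield_base.
(* Sums and products are obtained as [x - (0 - y)] and [x / (1 / y)]. *)
have KD x y : gen_subfield ambient_const gens x ->
    gen_subfield ambient_const gens y -> gen_subfield ambient_const gens (x + y).
  move=> Kx Ky; rewrite -[y]opprK -[- y]sub0r.
  by do 2?apply: gen_subfield_sub.
have KM x y : gen_subfield ambient_const gens x ->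
    gen_subfield ambient_const gens y -> gen_subfield ambient_const gens (x * y).
  move=> Kx Ky; rewrite -[y]invrK -[y^-1]mul1r.
  by do 2?apply: gen_subfield_div.
elim/poly_ind: F => [|F c IH]; first by rewrite rmorph0.
rewrite (rmorphD (xi k a)) (rmorphM (xi k a)) /= xi_T xi_polyC tofrac_xi0.
apply: (KD); first apply: (KM) => //.
  by apply: gen_subfield_mem; rewrite mem_rcons mem_head.
apply: mmap_closed => [c'|i||]; [exact: gen_subfield_base | | exact: KD | exact: KM].
apply: gen_subfield_mem; rewrite mem_rcons inE; apply/orP; right.
by apply/mapP; exists i; rewrite ?mem_enum.
Qed.

End Ambient.

(** * The intersection of the subfield with the polynomial ring *)

Theorem theorem2p1 (k : fieldType) (m : nat) (a : 'I_m -> nat)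
    (m_gt0 : (0 < m)%N) (a_gt0 : forall i, (0 < a i)%N) :
  injective (xi k a) /\
  forall z : ambient_field k m,
    (gen_subfield ambient_const
       (rcons [seq alpha1 * beta i + tvar ^+ a i | i : 'I_m]
          (alpha2 / alpha1)) z /\
     exists p : ambient_poly k m, z = p%:F) <->
    exists F : {poly {mpoly k[m]}},
      symbolic_rees (curve_ideal k a) F /\ z = xi k a F.
Proof.
split; first exact: xi_inj.
move=> z; split=> [[/(gen_subfield_fraction a_gt0)[G [H [H0 zGH]]] [p zp]]|[F [PF ->]]].
  have [N [q [Gq psi_q _]]] := xi_clear_denom G a_gt0.
  have [M [r [Hr psi_r _]]] := xi_clear_denom H a_gt0.
  have xiH0 : xi k a H != 0 by rewrite -(inj_eq (xi_inj a_gt0)) rmorph0 in H0.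
  have zH : z * xi k a H = xi k a G by rewrite zGH divfK.
  pose F := to_xT p.
  have FH : F * H = G.
    (* In the field both sides equal $\alpha_1^{N+M}\xi(G)$; applying [to_xT] leaves [F * H = G]. *)
    have /(congr1 (@to_xT k m)) : 'X_(lshift 1 (lshift m 0)) ^+ N * (p * r) =
        'X_(lshift 1 (lshift m 0)) ^+ M * q.
      apply/eqP; rewrite -tofrac_eq !tofracM !tofracXn -Hr -Gq -zp -zH.
      by rewrite [z * (_ * _)]mulrCA [X in X == _]mulrCA.
    rewrite !rmorphM !rmorphXn /= psi_q psi_r -/F /to_xT !ambient_evalE.
    by rewrite !expr1n !mul1r.
  have zF : z = xi k a F by apply: (mulIf xiH0); rewrite zH -rmorphM FH.
  by exists F; split=> //; apply: (ambient_symbolic_rees (p := p)); rewrite -?zF.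
by split; [exact: gen_subfield_xi | exact: symbolic_rees_ambient].
Qed.
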